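(* Let $\mathcal{P}$ be a projective plane of order $q$ with point set $P$, and let $G$ be an abelian subgroup of $\operatorname{Aut}\mathcal{P}$. Let $p$ be a point and $\ell$ a line such that the stabilizers $G_p$ and $G_\ell$ are trivial, and suppose $\ell$ contains exactly $d$ points of $P \setminus Gp$, where $Gp = \{p^g : g \in G\}$ is the $G$-orbit of $p$. Then \[ S = \{g \in G : p^g \in \ell\} \] is a Sidon set in $G$ of size $q + 1 - d$, and \[ d \leq (q+1) \left( \frac{q^2+q+1}{|G|} - 1 \right). \]
   Context: An incidence structure $(P, L, I)$ is a triple of sets with $I \subset P \times L$; elements of $P$ are points, elements of $L$ are lines, and $p \in \ell$ means $(p,\ell) \in I$. A projective plane is an incidence structure in which any two distinct points are incident with exactly one common line and any two distinct lines are incident with exactly one common point. A (finite) projective plane has order $q$ (a positive integer) if it has $q^2+q+1$ points and $q^2+q+1$ lines, every line contains exactly $q+1$ points, and every point lies on exactly $q+1$ lines. $\operatorname{Aut}\mathcal{P}$ is the group of automorphisms (collineations) of $\mathcal{P}$, i.e. pairs of bijections of $P$ and of $L$ preserving incidence in both directions. For a group $G$ acting on a set, $x^g$ denotes the image of $x$ under $g$ and $G_x$ denotes the stabilizer of $x$. A subset $S$ of an abelian group $G$ (written multiplicatively) is a Sidon set if for all $x,y,z,w \in S$, $xy=zw$ implies $\{x,y\}=\{z,w\}$. *)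

(* Defs.v *)
From HB Require Import structures.
From mathcomp Require Import all_boot all_order all_algebra all_fingroup.

Set Implicit Arguments.
Unset Strict Implicit.
Unset Printing Implicit Defensive.

Import Order.TTheory GRing.Theory Num.Theory GroupScope.

(* There is no nondegeneracy axiom; for a plane of a given positive order it
   is replaced by the counts below, so order 1 (the triangle) is allowed. *)
Definition projective_plane (P L : finType) (inc : P -> L -> bool) : Prop :=
  (forall x y : P, x != y -> exists! l : L, inc x l /\ inc y l) /\
  (forall l m : L, l != m -> exists! x : P, inc x l /\ inc x m).

Definition has_order (P L : finType) (inc : P -> L -> bool) (q : nat) : Prop :=
  [/\ (0 < q)%N,
      #|P| = (q ^ 2 + q + 1)%N,
      #|L| = (q ^ 2 + q + 1)%N,
      forall l : L, #|[set x : P | inc x l]| = (q + 1)%N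
    & forall x : P, #|[set l : L | inc x l]| = (q + 1)%N].

Notation perm_pair P L := ({perm P} * {perm L})%type.

Definition collineations (P L : finType) (inc : P -> L -> bool) :
    {set perm_pair P L} :=
  [set g : perm_pair P L | [forall x : P, forall l : L, inc (g.1 x) (g.2 l) == inc x l]].

Lemma collineations_group_set (P L : finType) (inc : P -> L -> bool) :
  group_set (collineations inc).
Proof.
apply/group_setP; split=> [|g h].
  by rewrite inE; apply/'forall_forallP=> x l; rewrite !perm1.
rewrite !inE => /'forall_'forall_eqP gP /'forall_'forall_eqP hP.
by apply/'forall_'forall_eqP=> x l; rewrite !permM hP gP.
Qed.

Canonical collineations_group (P L : finType) (inc : P -> L -> bool) :=
  Group (collineations_group_set inc).

Definition point_act (P L : finType) (x : P) (g : perm_pair P L) : P := g.1 x.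

Definition line_act (P L : finType) (l : L) (g : perm_pair P L) : L := g.2 l.

Lemma point_act1 (P L : finType) (x : P) : point_act x (1 : perm_pair P L) = x.
Proof. by rewrite /point_act perm1. Qed.

Lemma point_actM (P L : finType) (x : P) (g h : perm_pair P L) :
  point_act x (g * h) = point_act (point_act x g) h.
Proof. by rewrite /point_act permM. Qed.

Lemma line_act1 (P L : finType) (l : L) : line_act l (1 : perm_pair P L) = l.
Proof. by rewrite /line_act perm1. Qed.

Lemma line_actM (P L : finType) (l : L) (g h : perm_pair P L) :
  line_act l (g * h) = line_act (line_act l g) h.
Proof. by rewrite /line_act permM. Qed.

Canonical point_action (P L : finType) :=
  TotalAction (@point_act1 P L) (@point_actM P L).

Canonical line_action (P L : finType) :=
  TotalAction (@line_act1 P L) (@line_actM P L).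

Definition sidon_set (gT : finGroupType) (G S : {set gT}) : Prop :=
  S \subset G /\
  {in S & S & S, forall x y z, forall w, w \in S ->
     x * y = z * w -> [set x; y] = [set z; w]}.

(* Main.v *)
Require Import Defs.
From mathcomp Require Import all_boot all_order all_algebra all_fingroup.
From mathcomp Require Import zify.

(* Translating by g = x^-1 z turns a relation x y = z w in S into two points
   p^y and p^z common to l and l^g, so that l = l^g or p^y = p^z.  The bound on
   d comes from double counting the incidences between the |G| distinct lines
   l^g, each of which meets the complement of the orbit of p in d points, and
   the q^2 + q + 1 - |G| points of that complement, each on q + 1 lines. *)

Set Implicit Arguments.
Unset Strict Implicit.
Unset Printing Implicit Defensive.

Import Order.TTheory GRing.Theory Num.Theory GroupScope.

Lemma trivial_stab_inj (aT : finGroupType) (T : finType)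
    (to : {action aT &-> T}) (G : {group aT}) (x : T) :
  'C_G[x | to] = 1 -> {in G &, injective (to x)}.
Proof.
move=> stab1 a b aG bG eq_ab; apply/eqP; rewrite eq_mulgV1 -in_set1.
rewrite -[[set 1]]stab1 inE groupM ?groupV //=; apply/astab1P.
by rewrite actM eq_ab actK.
Qed.

Lemma collineation_inc (P L : finType) (inc : P -> L -> bool)
    (g : perm_pair P L) (x : P) (l : L) : g \in collineations inc ->
  inc (point_action P L x g) (line_action P L l g) = inc x l.
Proof. by rewrite inE => /'forall_'forall_eqP/(_ x l). Qed.

Lemma common_point_uniq (P L : finType) (inc : P -> L -> bool)
    (l m : L) (x y : P) : projective_plane inc -> l != m ->
  inc x l -> inc x m -> inc y l -> inc y m -> x = y.
Proof.
move=> [_ meet] /meet[z [_ uniq_z]] xl xm yl ym.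
by rewrite -(uniq_z x) // -(uniq_z y).
Qed.

Section RegularOrbits.

Variables (P L : finType) (inc : P -> L -> bool) (G : {group perm_pair P L}).
Variables (p : P) (l : L).
Hypothesis Gcol : G \subset collineations inc.
Hypothesis Gp1 : 'C_G[p | point_action P L] = 1.
Hypothesis Gl1 : 'C_G[l | line_action P L] = 1.

Let orb := orbit (point_action P L) G p.
Let S := [set g in G | inc (point_action P L p g) l].

Lemma line_orbit_sidon : projective_plane inc -> abelian G -> sidon_set G S.
Proof.
move=> plane abG; split; first by apply/subsetP=> g /[!inE] /andP[].
move=> x y z; rewrite !inE => /andP[xG xl] /andP[yG yl] /andP[zG zl] w.
rewrite inE => /andP[wG wl] xy_zw.
(* Commutativity gives [y = w * g] with [g = x^-1 * z], while [z = x * g] always holds. Thus [g]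
   carries the points of [l] given by [w] and [x] to those given by [y] and [z], which therefore lie
   on the translate of [l] by [g]. *)
have def_y : y = w * (x^-1 * z).
  rewrite (centsP abG w) ?groupM ?groupV // -mulgA -xy_zw; exact/esym/mulKg.
have gG : x^-1 * z \in G by rewrite groupM ?groupV.
have gcol := subsetP Gcol _ gG.
have zlg : inc (point_action P L p z) (line_action P L l (x^-1 * z)).
  by rewrite -[in point_action P L p z](mulKVg x z) actM collineation_inc.
have ylg : inc (point_action P L p y) (line_action P L l (x^-1 * z)).
  by rewrite [in point_action P L p y]def_y actM collineation_inc.
(* If [g] fixes [l], then [g = 1], so [x = z] and [y = w]. Otherwise the two lines share only one
   point, so [y = z], and cancellation leaves [x = w]: the same pair, swapped. *)
have [l_fix | l_moved] := eqVneq l (line_action P L l (x^-1 * z)).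
  have g1 : x^-1 * z = 1.
    by apply: (trivial_stab_inj Gl1); rewrite ?act1.
  have xz : x = z by apply/esym/eqP; rewrite eq_mulVg1 -eq_invg1 invMg invgK g1.
  by rewrite def_y g1 mulg1 xz.
have yz : y = z.
  apply: (trivial_stab_inj Gp1) => //.
  exact: (common_point_uniq plane l_moved).
by move: xy_zw; rewrite yz -(centsP abG w) // => /mulIg->; rewrite setUC.
Qed.

(** As the stabilizer of [p] is trivial, moving [p] by [g] is a bijection from [S] onto the orbit
    points of [l]. *)
Lemma card_line_orbit : #|S| = #|[set x | inc x l] :&: orb|.
Proof.
rewrite -(card_in_imset (f := point_action P L p)); last first.
  by move=> a b /setIdP[aG _] /setIdP[bG _]; apply: (trivial_stab_inj Gp1).
congr #|pred_of_set _|; apply/setP=> x; rewrite !inE.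
apply/imsetP/andP => [[g /setIdP[gG gl] ->] | [xl /orbitP[g gG def_x]]].
  by split=> //; apply: mem_orbit.
by exists g; rewrite // inE gG /= def_x.
Qed.

Lemma card_regular_orbit : #|orb| = #|G|.
Proof. exact/card_in_imset/trivial_stab_inj. Qed.

(** The permutation [g] of the points preserves the orbit, hence its complement, and maps [l] onto
    its translate. *)
Lemma card_off_orbit_translate (g : perm_pair P L) : g \in G ->
  #|[set x | inc x (line_action P L l g)] :\: orb| =
  #|[set x | inc x l] :\: orb|.
Proof.
move=> gG; rewrite -(card_preimset _ (act_inj (point_action P L) g)).
congr #|pred_of_set _|; apply/setP=> x; rewrite !inE.
by rewrite collineation_inc ?(subsetP Gcol) // (orbit_actr _ _ _ gG).
Qed.

Lemma off_orbit_incidences (k : nat) :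
    (forall x : P, #|[set m : L | inc x m]| <= k)%N ->
  (#|[set x | inc x l] :\: orb| * #|G| <= k * (#|P| - #|G|))%N.
Proof.
move=> deg_le; rewrite mulnC -sum_nat_const.
under eq_bigr => g gG do rewrite -(card_off_orbit_translate gG) -sum1_card.
under eq_bigr do under eq_bigl do rewrite setDE inE andbC.
(* The right side becomes a sum of [k] over the points off the orbit, to be compared termwise once
   the double sum is exchanged. *)
rewrite -card_regular_orbit -[#|P|](cardsC orb) addKn mulnC -sum_nat_const.
under eq_bigr do rewrite big_mkcondr /=.
rewrite exchange_big; apply: leq_sum => x _ /=.
under eq_bigr do rewrite inE; rewrite -big_mkcondr sum1_card.
(* For fixed [x] the inner sum counts the [g] whose translate of [l] contains [x]. Distinct [g] give
   distinct translates, so this is at most the number of lines through [x]. *)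
rewrite -(card_in_image (f := line_action P L l)); last first.
  by move=> a b /andP[aG _] /andP[bG _]; apply: (trivial_stab_inj Gl1).
apply: leq_trans (deg_le x); apply/subset_leq_card/subsetP=> m.
by case/imageP=> g /andP[_ xg] ->; rewrite inE.
Qed.

End RegularOrbits.

Theorem corollary2p4 (P L : finType) (inc : P -> L -> bool) (q : nat)
    (hplane : projective_plane inc) (hq : has_order inc q)
    (G : {group perm_pair P L})
    (hG : G \subset collineations inc) (hab : abelian G)
    (p : P) (l : L)
    (hp : 'C_G[p | point_action P L] = 1)
    (hl : 'C_G[l | line_action P L] = 1)
    (d : nat)
    (hd : #|[set x : P | inc x l] :\: orbit (point_action P L) G p| = d) :
  let S := [set g in G | inc (point_action P L p g) l] in
  [/\ sidon_set G S,
      (#|S|%:Z = q%:Z + 1 - d%:Z)%R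
    & (d%:R <= (q%:R + 1) * ((q%:R ^+ 2 + q%:R + 1) / #|G|%:R - 1) :> rat)%R].
Proof.
case: hq => q_gt0 cardP cardL card_line deg_point S.
have cardS : (#|S| + d = q + 1)%N.
  by rewrite card_line_orbit // -hd -(card_line l); apply: cardsID.
have G_gt0 : (0 < #|G|%:R :> rat)%R by rewrite ltr0n cardG_gt0.
(* This makes the truncated subtraction in [dG] a genuine one, so that it can be cast to [rat]. *)
have leGP : (#|G| <= q ^ 2 + q + 1)%N.
  by rewrite -cardP -(card_regular_orbit hp) max_card.
have dG : (d * #|G| <= (q + 1) * (q ^ 2 + q + 1 - #|G|))%N.
  by rewrite -hd -cardP off_orbit_incidences // => x; rewrite deg_point.
split; first exact: line_orbit_sidon.
  by move: cardS; lia.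
rewrite -(ler_pM2r G_gt0) -mulrA mulrBl mul1r divfK ?gt_eqF //.
by move: dG; rewrite -(ler_nat rat) !natrM natrB // !natrD natrX.
Qed.
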